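(* Let $q$ be a prime power, let $m\ge1$ and $t$ be integers with $t+1\mid m$, and let $H(x)\in\mathbb F_q[x]$ be a monic irreducible polynomial of degree $t+1$. Let $L\subseteq\mathbb F_{q^m}$ be a set containing all the roots $\alpha_1,\alpha_2,\ldots,\alpha_{t+1}$ of $H(x)$. Let $\omega\in\mathbb F_{q^m}^*$ and $\lambda_i,\beta_i\in\mathbb F_q^*$ for $1\le i\le t+1$, and assume that $\sum_{i=1}^{t+1}\lambda_i\beta_i\ne0$. Define $$G(x)=\omega\sum_{i=1}^{t+1}\lambda_i\beta_i\frac{H(x)}{x-\alpha_i},$$ and assume that $G(\eta)\ne0$ for every $\eta\in L$. Then the $q$-ary Goppa code $\Gamma(L,G)$ has minimum distance $d(\Gamma(L,G))=t+1$.
   Context: Write $L=\{\alpha_1,\ldots,\alpha_n\}$ with $n=|L|$, the $\alpha_i$ distinct. For a polynomial $G(x)\in\mathbb F_{q^m}[x]$ of degree at most $n$ with $G(\alpha_i)\ne0$ for all $i$, the $q$-ary Goppa code with support $L$ and Goppa polynomial $G$ is $$\Gamma(L,G)=\Bigl\{(c_1,\ldots,c_n)\in\mathbb F_q^n\ \Big|\ \sum_{i=1}^n\frac{c_i}{x-\alpha_i}\equiv0\pmod{G(x)}\Bigr\},$$ where $\frac1{x-\alpha_i}$ denotes the inverse of $x-\alpha_i$ modulo $G(x)$. The minimum distance $d(\mathcal C)$ of a linear code $\mathcal C$ is the minimum number of nonzero coordinates of a nonzero codeword. *)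

(* Defs.v *)
From HB Require Import structures.
From mathcomp Require Import all_boot all_order all_algebra all_field.

Set Implicit Arguments.
Unset Strict Implicit.
Unset Printing Implicit Defensive.

Import GRing.Theory.
Local Open Scope ring_scope.

(* The inverse of p modulo G, read off the Bezout relation between p and G;
   it is an inverse only when p and G are coprime (see mulp_invmodp).
   {poly %/ G} is not used because it requires G monic and nonconstant. *)
Definition invmodp (K : fieldType) (G p : {poly K}) : {poly K} :=
  let e := egcdp p G in ((e.1 * p + e.2 * G)`_0)^-1 *: e.1 %% G.

Lemma mulp_invmodp (K : fieldType) (G p : {poly K}) :
  coprimep p G -> p * invmodp G p %% G = 1 %% G.
Proof.
move=> cop; rewrite /invmodp /=; set e := egcdp p G.
have /eqp_size szE : gcdp p G %= e.1 * p + e.2 * G by apply: egcdpE.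
have /size_poly1P[a a0 ea] : size (e.1 * p + e.2 * G) == 1%N by rewrite -szE.
rewrite ea coefC /= modp_mul -scalerAr [p * _]mulrC.
have -> : e.1 * p = a%:P - e.2 * G by rewrite -ea addrK.
rewrite scalerBr modpD [_ *: (e.2 * G)]scalerAl -mulNr modp_mull addr0.
by rewrite -mul_polyC -polyCM mulVf.
Qed.

(* G is meant to have no root in L, so that each 'X - L_i is invertible
   modulo G. *)
Definition goppa_code (F : finFieldType) (K : fieldExtType F) (n : nat)
    (L : n.-tuple K) (G : {poly K}) : {set 'rV[F]_n} :=
  [set c : 'rV[F]_n |
    G %| \sum_(i < n) (c 0 i)%:A *: invmodp G ('X - (tnth L i)%:P)].

Definition hweight (F : finFieldType) (n : nat) (c : 'rV[F]_n) : nat :=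
  #|[set i | c 0 i != 0]|.

(* Equal to 0 when C has no nonzero codeword, since [arg min] then returns
   its default value, here the zero word. *)
Definition min_distance (F : finFieldType) (n : nat) (C : {set 'rV[F]_n}) : nat :=
  hweight [arg min_(c < 0 | (c \in C) && (c != 0)) hweight c].

Lemma min_distanceP (F : finFieldType) (n : nat) (C : {set 'rV[F]_n})
    (c0 : 'rV[F]_n) : c0 \in C -> c0 != 0 ->
  (exists c, [/\ c \in C, c != 0 & hweight c = min_distance C]) /\
  (forall c, c \in C -> c != 0 -> (min_distance C <= hweight c)%N).
Proof.
move=> c0C c0n; rewrite /min_distance /arg_min /extremum.
have P0 : (c0 \in C) && (c0 != 0) by rewrite c0C.
case: pickP => [c /andP[/andP[cC cn] /forallP cmin] | nomin] /=.
  split; first by exists c.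
  by move=> c' c'C c'n; have := cmin c'; rewrite c'C c'n.
case: (@arg_minnP _ c0 (fun c => (c \in C) && (c != 0)) (@hweight F n) P0) => c Pc cmin.
have := nomin c; rewrite /= Pc /= => /negP[]; apply/forallP => c'.
by apply/implyP/cmin.
Qed.

(* Main.v *)
(** Clearing denominators, a word supported on the positions A lies in the code
    iff G divides the sum over i in A of c_i times the product of the x - L_j
    for j in A other than i. For A the support of c this numerator is nonzero of
    degree less than the weight of c, whence d >= deg G + 1 = t + 1, the leading
    coefficient of G being omega times the sum of the lambda_i beta_i. For A the
    positions of the roots of H and c_i = lambda_i beta_i the numerator is
    G / omega, so this word of weight t + 1 is a codeword. The roots of H in K
    are t + 1 distinct elements because H divides x^|K| - x. *)
Require Import Defs.
From HB Require Import structures.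
From mathcomp Require Import all_boot all_order all_algebra all_field.

Set Implicit Arguments.
Unset Strict Implicit.
Unset Printing Implicit Defensive.

Import GRing.Theory.
Local Open Scope ring_scope.

(** The product [P] of the linear factors over [A] is coprime to [G], so multiplying the defining
    sum by [P] does not affect divisibility by [G]; modulo [G], each inverse then cancels its own
    factor of [P]. *)
Lemma goppa_codeP (F : finFieldType) (K : fieldExtType F) (n : nat)
    (L : n.-tuple K) (G : {poly K}) (A : {set 'I_n}) (c : 'rV[F]_n) :
  (forall eta, eta \in L -> G.[eta] != 0) ->
  (forall i, i \notin A -> c 0 i = 0) ->
  (c \in goppa_code L G) =
  (G %| \sum_(i in A) (c 0 i)%:A *:
          \prod_(j in A :\ i) ('X - (tnth L j)%:P)).
Proof.
move=> GL cA; rewrite inE.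
have copG j : coprimep ('X - (tnth L j)%:P) G.
  by rewrite coprimep_sym coprimep_XsubC; apply/GL/mem_tnth.
pose P := \prod_(j in A) ('X - (tnth L j)%:P).
have copP : coprimep G P.
  rewrite coprimep_sym /P.
  elim/big_ind: _ => [|p r cp cr|j _]; first exact: coprime1p.
    by rewrite coprimepMl cp cr.
  exact: copG.
rewrite -(Gauss_dvdpr _ copP) (bigID (mem A)) /=.
rewrite [X in _ + X]big1 ?addr0; last by move=> i /cA->; rewrite !scale0r.
rewrite /dvdp; congr (_ == _).
rewrite mulr_sumr !(big_morph (fun p => p %% G) (@modpD _ G) (@mod0p _ G)).
apply: eq_bigr => i iA.
rewrite /P (big_setD1 i iA) /= -scalerAr !modpZl; congr (_ *: _).
by rewrite mulrAC mulrC -modp_mul mulp_invmodp // modp_mul mulr1.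
Qed.

Lemma goppa_code_weight (F : finFieldType) (K : fieldExtType F) (n : nat)
    (L : n.-tuple K) (G : {poly K}) (c : 'rV[F]_n) :
  uniq L -> (forall eta, eta \in L -> G.[eta] != 0) ->
  c \in goppa_code L G -> c != 0 -> (size G <= hweight c)%N.
Proof.
move=> uL GL; rewrite (@goppa_codeP _ _ _ _ _ [set i | c 0 i != 0]) //; last first.
  by move=> i; rewrite inE negbK => /eqP.
rewrite /hweight; set A := [set i | _]; set N := \sum_(i in A) _ => GN c0.
have [i iA] : exists i, i \in A.
  by have /rV0Pn[i ci] := c0; exists i; rewrite inE.
have ci : (c 0 i)%:A != 0 :> K.
  by move: iA; rewrite inE scaler_eq0 oner_eq0 orbF.
(* At [L_i] every other summand vanishes, as it contains the factor ['X - L_i]; the remaining value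
   is nonzero because the entries of [L] are distinct. *)
have Ni : N.[tnth L i] =
    (c 0 i)%:A * \prod_(j in A :\ i) (tnth L i - tnth L j).
  rewrite /N horner_sum (bigD1 i iA) /= [X in _ + X]big1 ?addr0.
    by rewrite hornerZ horner_prod; under eq_bigr do rewrite hornerXsubC.
  move=> j /andP[jA ji]; rewrite hornerZ horner_prod (bigD1 i) /=.
    by rewrite hornerXsubC subrr mul0r mulr0.
  by rewrite in_setD1 eq_sym ji.
have N0 : N != 0.
  apply: contraNneq ci => N0; move: Ni.
  rewrite N0 horner0 => /esym/eqP; rewrite mulf_eq0 => /orP[//|].
  case/prodf_eq0=> j; rewrite in_setD1 => /andP[ji _].
  by rewrite subr_eq0 (inj_eq (tuple_uniqP L uL)) eq_sym (negPf ji).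
(* Size is degree plus one: a summand with [#|A| - 1] linear factors has size at most [#|A|]. *)
apply: leq_trans (dvdp_leq N0 GN) _.
apply: leq_trans (size_sum _ _ _) _; apply/bigmax_leqP => j jA.
apply: leq_trans (size_scale_leq _ _) _.
by rewrite -big_enum size_prod_XsubC -cardE (cardsD1 j A) jA.
Qed.

(** Otherwise [H] and [p] are coprime over [F], hence over [K], and cannot share a root. *)
Lemma root_in_alg_dvdp (F : fieldType) (K : fieldExtType F) (H p : {poly F})
    (x : K) : irreducible_poly H ->
  root (map_poly (in_alg K) H) x -> root (map_poly (in_alg K) p) x -> H %| p.
Proof.
move=> Hirr Hx px; apply: contraLR Hx => nHp.
have : coprimep H p by rewrite irreducible_poly_coprime.
by rewrite -(coprimep_map (in_alg K)) => /coprimep_root h; apply: contraTN px => /h.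
Qed.

Lemma irreducible_finField_split (F : finFieldType) (K : fieldExtType F)
    (H : {poly F}) (x : K) :
  irreducible_poly H -> H \is monic -> root (map_poly (in_alg K) H) x ->
  exists2 s : seq K, uniq s & map_poly (in_alg K) H = \prod_(a <- s) ('X - a%:P).
Proof.
(* [fK] is [K] with its finite field structure, which gives meaning to its cardinality. *)
move=> Hirr Hmon Hx; pose fK := finvect_type K.
have HX : map_poly (in_alg K) H %| 'X^#|{: fK}| - 'X.
  have -> : 'X^#|{: fK}| - 'X = map_poly (in_alg K) ('X^#|{: fK}| - 'X).
    by rewrite rmorphB /= map_polyXn map_polyX.
  rewrite dvdp_map; apply: (root_in_alg_dvdp Hirr Hx).
  rewrite rmorphB /= map_polyXn map_polyX rootE !hornerE subr_eq0.
  exact/eqP/(@expf_card fK).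
have [r rU Xr] : exists2 r : seq K, uniq r &
    'X^#|{: fK}| - 'X = \prod_(a <- r) ('X - a%:P).
  exists (enum fK : seq K); first exact: (enum_uniq fK).
  by rewrite (@big_enum _ _ _ _ fK) (@finField_genPoly fK).
move: HX; rewrite Xr => /dvdp_prod_XsubC[b Hb].
exists (mask b r); first exact: mask_uniq.
apply/eqP; rewrite -eqp_monic ?monic_prod_XsubC //.
exact: monic_map.
Qed.

Theorem mainTheorem2 (q : nat) (F : finFieldType) (hq : #|F| = q)
    (m : nat) (hm : (0 < m)%N) (K : fieldExtType F) (hK : \dim {:K} = m)
    (t : nat) (htm : (t.+1 %| m)%N)
    (H : {poly F}) (Hmonic : H \is monic) (Hirr : irreducible_poly H)
    (Hdeg : (size H).-1 = t.+1)
    (alpha : 'I_t.+1 -> K)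
    (halpha : forall x : K,
        root (map_poly (in_alg K) H) x <-> exists i, x = alpha i)
    (n : nat) (L : n.-tuple K) (hL : uniq L)
    (hroots : forall i, alpha i \in L)
    (omega : K) (homega : omega != 0)
    (lambda beta : 'I_t.+1 -> F)
    (hlambda : forall i, lambda i != 0) (hbeta : forall i, beta i != 0)
    (hsum : \sum_(i < t.+1) lambda i * beta i != 0)
    (G : {poly K})
    (hG : G = omega *: \sum_(i < t.+1)
        (lambda i * beta i)%:A *:
          (map_poly (in_alg K) H %/ ('X - (alpha i)%:P)))
    (hGL : forall eta, eta \in L -> G.[eta] != 0) :
  min_distance (goppa_code L G) = t.+1.
Proof.
set HK := map_poly _ H in halpha hG.
have [s sU Hs] : exists2 s : seq K, uniq s & HK = \prod_(a <- s) ('X - a%:P).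
  apply: (irreducible_finField_split (x := alpha ord0)) => //.
  by apply/halpha; exists ord0.
have szs : size s = t.+1.
  by rewrite -Hdeg -(size_map_poly (in_alg K)) -/HK Hs size_prod_XsubC.
have s_alpha : {subset s <= codom alpha}.
  move=> x; rewrite -root_prod_XsubC -Hs => /halpha[i ->].
  exact: codom_f.
have sz_alpha : (size (codom alpha) <= size s)%N.
  by rewrite size_codom card_ord szs.
(* [halpha] gives only the set of values of [alpha]; the [t.+1] distinct roots in [s] all occur
   among [t.+1] values, so no value repeats. *)
have alpha_inj : injective alpha.
  exact/injectiveP/(leq_size_uniq sU s_alpha sz_alpha).
have /fin_all_exists[idx idxE] i : exists j, alpha i = tnth L j.
  exact/tnthP/hroots.
have idx_inj : injective idx.
  by move=> i j eq_ij; apply: alpha_inj; rewrite !idxE eq_ij.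
pose A := [set idx i | i in 'I_t.+1].
have cardA : #|A| = t.+1 by rewrite card_imset ?card_ord.
have HA : HK = \prod_(j in A) ('X - (tnth L j)%:P).
  rewrite big_imset /=; last by move=> i j _ _; apply: idx_inj.
  rewrite Hs (perm_big (codom alpha)).
    by rewrite big_image /=; apply: eq_bigr => i _; rewrite idxE.
  apply: uniq_perm => //; first exact/injectiveP.
  by have [] := uniq_min_size sU s_alpha sz_alpha.
have Hdiv i :
    HK %/ ('X - (alpha i)%:P) = \prod_(j in A :\ idx i) ('X - (tnth L j)%:P).
  rewrite HA (big_setD1 (idx i)) ?imset_f //= idxE mulKp //.
  by rewrite polyXsubC_eq0.
(* As [idx] is injective, each sum has at most one term; the empty sum gives the zeros off [A]. *)
pose c : 'rV[F]_n := \row_j \sum_(i | idx i == j) lambda i * beta i.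
have c_idx i : c 0 (idx i) = lambda i * beta i.
  by rewrite mxE (big_pred1 i) // => j; rewrite /= (inj_eq idx_inj).
have cA j : j \notin A -> c 0 j = 0.
  move=> jA; rewrite mxE big_pred0 // => i.
  by apply: contraNF jA => /eqP<-; apply: imset_f.
have c_supp : [set j | c 0 j != 0] = A.
  apply/setP=> j; rewrite inE.
  have [/imsetP[i _ ->]|/cA->] := boolP (j \in A); last by rewrite eqxx.
  by rewrite c_idx mulf_neq0.
have wc : hweight c = t.+1 by rewrite /hweight c_supp.
have c0 : c != 0.
  apply/rV0Pn; exists (idx ord0).
  by rewrite c_idx mulf_neq0.
have cG : c \in goppa_code L G.
  rewrite (goppa_codeP hGL cA).
  rewrite big_imset /=; last by move=> i j _ _; apply: idx_inj.
  rewrite hG dvdpZl //.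
  by under [X in X %| _]eq_bigr do rewrite Hdiv -c_idx.
(* Each quotient of [HK] by a linear factor is monic of degree [t], so the coefficient of [G] at [t]
   is [omega] times the nonzero sum in [hsum]. *)
have szG : (t < size G)%N.
  rewrite ltnNge; apply/negP => /leq_sizeP/(_ t (leqnn t))/eqP.
  rewrite hG coefZ mulf_eq0 (negPf homega) coef_sum /=.
  have -> : \sum_(i < t.+1)
        ((lambda i * beta i)%:A *: (HK %/ ('X - (alpha i)%:P)))`_t
      = (\sum_(i < t.+1) lambda i * beta i)%:A.
    rewrite scaler_suml; apply: eq_bigr => i _; rewrite coefZ Hdiv.
    set p := \prod_(j in _) _.
    have szp : size p = t.+1.
      rewrite /p -big_enum size_prod_XsubC -cardE -cardA.
      by rewrite (cardsD1 (idx i) A) imset_f.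
    have /monicP : p \is monic by rewrite /p -big_enum; apply: monic_prod_XsubC.
    by rewrite lead_coefE szp /= => ->; rewrite mulr1.
  by rewrite scaler_eq0 oner_eq0 orbF (negPf hsum).
have [[c' [c'G c'0 mc]] min_le] := min_distanceP cG c0.
apply/eqP; rewrite eqn_leq; apply/andP; split.
  by rewrite -wc min_le.
rewrite -mc; exact: leq_trans szG (goppa_code_weight hL hGL c'G c'0).
Qed.
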